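(* Let $G=\mathrm{Gal}(\bar{\mathbb{Q}}/\mathbb{Q})$, let $K\subset\bar{\mathbb{Q}}$ be a finite Galois extension of $\mathbb{Q}$, $H=\mathrm{Gal}(\bar{\mathbb{Q}}/K)$, let $(\pi,W)$ be a Galois representation of $G$, and $\rho=\mathrm{Ind}_H^G(\pi|_H)$. Let $L=\{(\pi(g),\rho(g))\mid g\in G\}$ and let $\Phi:L\to\pi(G)$ be the projection $\Phi((\pi(g),\rho(g)))=\pi(g)$. Suppose $\pi(G)=\pi(H)$. Then the exact sequence $$1\to\ker(\Phi)\hookrightarrow L\xrightarrow{\Phi}\pi(G)\to1$$ is right split, and $L\cong\pi(G)\ltimes G/H$ for some semidirect product group law.
   Context: Let $E$ be a number field, $\Lambda$ a prime of its ring of integers, and $E_\Lambda$ the completion. A Galois representation $(\pi,W)$ is a finite-dimensional $E_\Lambda$-vector space $W$ with a continuous homomorphism $\pi:G\to\mathrm{GL}(W)$. The induced representation $\rho=\mathrm{Ind}_H^G(\pi|_H)$ acts on $V=\{f:G\to W \mid f(hg)=\pi(h)f(g)\ \forall h\in H,\ g\in G\}$ by $(\rho(g)f)(x)=f(xg)$. $L$ is a group under componentwise multiplication (a subgroup of $\pi(G)\times\rho(G)$). A short exact sequence $1\to A\to B\xrightarrow{\Phi}C\to1$ is right split if there is a homomorphism $\iota:C\to B$ with $\Phi\circ\iota=\mathrm{id}_C$. In $\pi(G)\ltimes G/H$ the normal factor is $G/H$.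
   Formalization: The representation space W is assumed nonzero; for W = 0 and K ≠ ℚ the isomorphism fails, since then π(G) = π(H) = 1 and L is trivial while G/H is not. *)

(* Defs.v *)
From HB Require Import structures.
From mathcomp Require Import all_boot all_order all_algebra all_field.
From mathcomp Require Import all_classical all_reals all_analysis.

Set Implicit Arguments.
Unset Strict Implicit.
Unset Printing Implicit Defensive.

Import Order.TTheory GRing.Theory Num.Theory.

Local Open Scope classical_set_scope.
Local Open Scope ring_scope.

(* Groups of bijections T -> T preserving some structure on T; the law is
   composition, (f * g) x = f (g x). *)

Record selfmap_class (T : Type) := SelfmapClass {
  in_selfmap :> (T -> T) -> Prop;
  selfmap_id : in_selfmap id;
  selfmap_comp : forall f g,
    in_selfmap f -> in_selfmap g -> in_selfmap (f \o g);
  selfmap_inv : forall f g, cancel f g -> cancel g f ->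
    in_selfmap f -> in_selfmap g }.

Record autg (T : choiceType) (P : selfmap_class T) := Autg {
  autg_fun :> T -> T;
  autg_prop : `[< bijective autg_fun /\ P autg_fun >] }.

HB.instance Definition _ (T : choiceType) (P : selfmap_class T) :=
  [isSub for @autg_fun T P].
HB.instance Definition _ (T : choiceType) (P : selfmap_class T) :=
  [Choice of autg P by <:].

Section AutgGroup.
Context (T : choiceType) (P : selfmap_class T).
Implicit Types f g h : autg P.

Lemma autg_bij f : bijective f.
Proof. by have /asboolP[] := autg_prop f. Qed.

Lemma autg_in f : P f.
Proof. by have /asboolP[] := autg_prop f. Qed.

Lemma autgP f g : f =1 g -> f = g.
Proof. by move=> fg; apply/val_inj/funext. Qed.

Lemma autg_inv_ex f : exists g : T -> T, cancel f g /\ cancel g f.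
Proof. by have [g fK gK] := autg_bij f; exists g. Qed.

Definition autg_invfun f : T -> T := projT1 (cid (autg_inv_ex f)).

Lemma autg_invfunK f : cancel f (autg_invfun f).
Proof. by rewrite /autg_invfun; case: cid => g []. Qed.

Lemma autg_invfunVK f : cancel (autg_invfun f) f.
Proof. by rewrite /autg_invfun; case: cid => g []. Qed.

Definition autg_one : autg P.
Proof.
by apply: (@Autg _ _ id); apply/asboolP; split; [exists id | exact: selfmap_id].
Defined.

Definition autg_mul f g : autg P.
Proof.
apply: (@Autg _ _ (f \o g)); apply/asboolP; split.
  exact: bij_comp (autg_bij f) (autg_bij g).
exact: selfmap_comp (autg_in f) (autg_in g).
Defined.

Definition autg_inv f : autg P.
Proof.
apply: (@Autg _ _ (autg_invfun f)); apply/asboolP; split.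
  by exists f; [exact: autg_invfunVK | exact: autg_invfunK].
exact: selfmap_inv (@autg_invfunK f) (@autg_invfunVK f) (autg_in f).
Defined.

Lemma autg_mulA : associative autg_mul.
Proof. by move=> f g h; apply: autgP. Qed.

Lemma autg_mul1 : left_id autg_one autg_mul.
Proof. by move=> f; apply: autgP. Qed.

Lemma autg_mulr1 : right_id autg_one autg_mul.
Proof. by move=> f; apply: autgP. Qed.

Lemma autg_mulV : left_inverse autg_one autg_inv autg_mul.
Proof. by move=> f; apply: autgP => x /=; rewrite autg_invfunK. Qed.

Lemma autg_mulrV : right_inverse autg_one autg_inv autg_mul.
Proof. by move=> f; apply: autgP => x /=; rewrite autg_invfunVK. Qed.

HB.instance Definition _ := isGroup.Build (autg P)
  autg_mulA autg_mul1 autg_mulr1 autg_mulV autg_mulrV.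

End AutgGroup.

Definition ring_selfmap (R : nzRingType) : selfmap_class R.
Proof.
apply: (@SelfmapClass R (fun f => zmod_morphism f /\ monoid_morphism f)).
- by split.
- move=> f g [fB [f1 fM]] [gB [g1 gM]]; split; last split => /=.
  + by move=> x y /=; rewrite gB fB.
  + by rewrite g1 f1.
  + by move=> x y /=; rewrite gM fM.
- move=> f g fK gK [fB [f1 fM]]; split; last split.
  + by move=> x y; apply: (can_inj fK); rewrite fB !gK.
  + by apply: (can_inj fK); rewrite gK f1.
  + by move=> x y; apply: (can_inj fK); rewrite fM !gK.
Defined.

Definition linear_selfmap (F : fieldType) (V : lmodType F) : selfmap_class V.
Proof.
apply: (@SelfmapClass V (fun f => linear f)).
- by [].
- by move=> f g fL gL a x y /=; rewrite gL fL.
- by move=> f g fK gK fL a x y; apply: (can_inj fK); rewrite fL !gK.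
Defined.

Definition group_selfmap (N : groupType) : selfmap_class N.
Proof.
apply: (@SelfmapClass N (fun f => {morph f : x y / (x * y)%g})).
- by [].
- by move=> f g fM gM x y /=; rewrite gM fM.
- by move=> f g fK gK fM x y; apply: (can_inj fK); rewrite fM !gK.
Defined.

Notation GL V := (autg (linear_selfmap V)).
Notation autogroup N := (autg (group_selfmap N)).

Section Subgroup.
Context (G : groupType) (H : groupClosed G).

Record subgroup := Subgroup { subg_val : G; subg_in : subg_val \in H }.

HB.instance Definition _ := [isSub for subg_val].
HB.instance Definition _ := [Choice of subgroup by <:].

Lemma subgroup_closed : group_closed (fun x => x \in H).
Proof. by split; [exact: gpred1 | move=> x y xH yH; exact: gpredF]. Qed.

HB.instance Definition _ := SubChoice_isSubGroup.Build G _ subgroup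
  subgroup_closed.

End Subgroup.
Coercion subg_val : subgroup >-> Group.sort.

Section ImageKernel.
Context (G G' : groupType) (f : {multiplicative G -> G'}).

Lemma group_morph1 : f 1%g = 1%g.
Proof. by apply: (mulgI (f 1%g)); rewrite -gmulfM !mulg1. Qed.

Lemma group_morphV x : f x^-1%g = (f x)^-1%g.
Proof. by apply: (mulgI (f x)); rewrite -gmulfM !mulgV group_morph1. Qed.

Definition imageg : {pred G'} := fun y => `[< exists x, y = f x >].

Lemma imageg1 : 1%g \in imageg.
Proof. by apply/asboolP; exists 1%g; rewrite group_morph1. Qed.

Lemma imagegM : mulg_closed imageg.
Proof.
move=> _ _ /asboolP[x ->] /asboolP[y ->]; apply/asboolP.
by exists (x * y)%g; rewrite gmulfM.
Qed.

Lemma imagegV : invg_closed imageg.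
Proof.
move=> _ /asboolP[x ->]; apply/asboolP.
by exists x^-1%g; rewrite group_morphV.
Qed.

HB.instance Definition _ := isMulClosed.Build G' imageg imagegM.
HB.instance Definition _ := isMul1Closed.Build G' imageg imageg1.
HB.instance Definition _ := isInvClosed.Build G' imageg imagegV.

Definition kernelg : {pred G} := fun x => f x == 1%g.

Lemma kernelg1 : 1%g \in kernelg.
Proof. by rewrite unfold_in group_morph1. Qed.

Lemma kernelgM : mulg_closed kernelg.
Proof.
by move=> x y; rewrite !unfold_in => /eqP x1 /eqP y1; rewrite gmulfM x1 y1 mul1g.
Qed.

Lemma kernelgV : invg_closed kernelg.
Proof.
by move=> x; rewrite !unfold_in => /eqP x1; rewrite group_morphV x1 invg1.
Qed.

HB.instance Definition _ := isMulClosed.Build G kernelg kernelgM.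
HB.instance Definition _ := isMul1Closed.Build G kernelg kernelg1.
HB.instance Definition _ := isInvClosed.Build G kernelg kernelgV.

End ImageKernel.

Record normalSubgroup (G : groupType) := NormalSubgroup {
  normal_pred :> groupClosed G;
  normalP : forall g x : G, x \in normal_pred -> (g * x * g^-1)%g \in normal_pred }.

Section Quotient.
Context (G : groupType) (N : normalSubgroup G).
Local Open Scope quotient_scope.

Definition coset_rel : rel G := fun x y => (x^-1 * y)%g \in N.

Lemma coset_rel_refl : reflexive coset_rel.
Proof. by move=> x; rewrite /coset_rel mulVg gpred1. Qed.

Lemma coset_rel_sym : symmetric coset_rel.
Proof.
suff sub x y : coset_rel x y -> coset_rel y x.
  by move=> x y; apply/idP/idP; exact: sub.
by rewrite /coset_rel => /gpredVr; rewrite invgM invgK.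
Qed.

Lemma coset_rel_trans : transitive coset_rel.
Proof.
move=> y x z; rewrite /coset_rel => xy yz.
by have := gpredM _ _ xy yz; rewrite -mulgA mulVKg.
Qed.

Canonical coset_equiv :=
  EquivRel coset_rel coset_rel_refl coset_rel_sym coset_rel_trans.

Definition quotientg := {eq_quot coset_equiv}.

HB.instance Definition _ := Choice.on quotientg.
HB.instance Definition _ := EqQuotient.on quotientg.

Definition cosetg (x : G) : quotientg := \pi_quotientg x.

Definition quotientg_one : quotientg := cosetg 1%g.
Definition quotientg_mul (a b : quotientg) : quotientg :=
  cosetg (repr a * repr b)%g.
Definition quotientg_inv (a : quotientg) : quotientg := cosetg (repr a)^-1%g.

Lemma cosetgP x y : reflect (cosetg x = cosetg y) ((x^-1 * y)%g \in N).
Proof. exact: (iffP (@eqquotP _ _ quotientg x y)). Qed.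

Lemma repr_cosetg x : ((repr (cosetg x))^-1 * x)%g \in N.
Proof. by apply/cosetgP; rewrite /cosetg reprK. Qed.

Lemma cosetg_mul x y : quotientg_mul (cosetg x) (cosetg y) = cosetg (x * y)%g.
Proof.
apply/cosetgP; set a := repr _; set b := repr _.
have -> : ((a * b)^-1 * (x * y) =
   (b^-1 * y) * (y^-1 * (a^-1 * x) * (y^-1)^-1))%g.
  by rewrite invgM invgK !mulgA mulgK.
by rewrite gpredM ?normalP ?repr_cosetg.
Qed.

Lemma cosetg_inv x : quotientg_inv (cosetg x) = cosetg x^-1%g.
Proof.
apply/cosetgP; rewrite invgK; set a := repr _.
have -> : (a * x^-1 = a * (a^-1 * x)^-1 * a^-1)%g.
  by rewrite invgM invgK !mulgA mulgK.
by rewrite normalP // gpredVr // repr_cosetg.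
Qed.

Lemma cosetg_surj a : exists x, a = cosetg x.
Proof. by exists (repr a); rewrite /cosetg reprK. Qed.

Lemma quotientg_mulA : associative quotientg_mul.
Proof.
move=> a b c; have [x ->] := cosetg_surj a; have [y ->] := cosetg_surj b.
by have [z ->] := cosetg_surj c; rewrite !cosetg_mul mulgA.
Qed.

Lemma quotientg_mul1 : left_id quotientg_one quotientg_mul.
Proof. by move=> a; have [x ->] := cosetg_surj a; rewrite cosetg_mul mul1g. Qed.

Lemma quotientg_mulr1 : right_id quotientg_one quotientg_mul.
Proof. by move=> a; have [x ->] := cosetg_surj a; rewrite cosetg_mul mulg1. Qed.

Lemma quotientg_mulV : left_inverse quotientg_one quotientg_inv quotientg_mul.
Proof.
by move=> a; have [x ->] := cosetg_surj a; rewrite cosetg_inv cosetg_mul mulVg.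
Qed.

Lemma quotientg_mulrV : right_inverse quotientg_one quotientg_inv quotientg_mul.
Proof.
by move=> a; have [x ->] := cosetg_surj a; rewrite cosetg_inv cosetg_mul mulgV.
Qed.

HB.instance Definition _ := isGroup.Build quotientg
  quotientg_mulA quotientg_mul1 quotientg_mulr1 quotientg_mulV quotientg_mulrV.

End Quotient.

(* The semidirect product of N (normal factor) and Q, for the action theta of Q
   on N by automorphisms. *)
Definition sdprodg (N Q : groupType) (theta : {multiplicative Q -> autogroup N}) :
  Type := (N * Q)%type.

Section Semidirect.
Context (N Q : groupType) (theta : {multiplicative Q -> autogroup N}).
Local Notation T := (sdprodg theta).

HB.instance Definition _ := Choice.on T.

Definition sdprodg_one : T := (1%g, 1%g).
Definition sdprodg_mul (a b : T) : T :=
  ((a.1 * theta a.2 b.1)%g, (a.2 * b.2)%g).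
Definition sdprodg_inv (a : T) : T := (theta a.2^-1%g a.1^-1%g, a.2^-1%g).

Lemma autM (s : autogroup N) : {morph s : x y / (x * y)%g}.
Proof. exact: (autg_in s). Qed.

Lemma aut1 (s : autogroup N) : s 1%g = 1%g.
Proof. by apply: (mulgI (s 1%g)); rewrite -autM !mulg1. Qed.

Lemma sdprodg_mulA : associative sdprodg_mul.
Proof.
move=> [a p] [b q] [c r]; congr pair; rewrite /= ?mulgA //.
by rewrite autM gmulfM mulgA.
Qed.

Lemma sdprodg_mul1 : left_id sdprodg_one sdprodg_mul.
Proof. by move=> [a p]; rewrite /sdprodg_mul /= group_morph1 !mul1g. Qed.

Lemma sdprodg_mulr1 : right_id sdprodg_one sdprodg_mul.
Proof. by move=> [a p]; rewrite /sdprodg_mul /= aut1 !mulg1. Qed.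

Lemma sdprodg_mulV : left_inverse sdprodg_one sdprodg_inv sdprodg_mul.
Proof.
by move=> [a p]; rewrite /sdprodg_mul /= -autM !mulVg aut1.
Qed.

Lemma sdprodg_mulrV : right_inverse sdprodg_one sdprodg_inv sdprodg_mul.
Proof.
move=> [a p]; rewrite /sdprodg_mul /=; congr pair; last exact: mulgV.
have -> : theta p (theta p^-1%g a^-1%g) = a^-1%g.
  have -> : theta p (theta p^-1%g a^-1%g) = (theta p * theta p^-1)%g a^-1%g by [].
  by rewrite -gmulfM mulgV group_morph1.
exact: mulgV.
Qed.

HB.instance Definition _ := isGroup.Build T
  sdprodg_mulA sdprodg_mul1 sdprodg_mulr1 sdprodg_mulV sdprodg_mulrV.

End Semidirect.

Definition isomorphicg (G G' : groupType) : Prop :=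
  exists f : {multiplicative G -> G'}, bijective f.

Definition short_exact (A B C : groupType)
    (i : {multiplicative A -> B}) (p : {multiplicative B -> C}) : Prop :=
  [/\ injective i, range i = [set b | p b = 1%g] & range p = setT].

Definition right_split (B C : groupType) (p : {multiplicative B -> C}) : Prop :=
  exists i : {multiplicative C -> B}, p \o i = id.

Section KernelInclusion.
Context (G : groupType) (H : groupClosed G).

Definition inclg (x : subgroup H) : G := x.

Lemma inclgM : {morph inclg : x y / (x * y)%g}. Proof. by []. Qed.
HB.instance Definition _ := isMultiplicative.Build (subgroup H) G inclg inclgM.

End KernelInclusion.
Arguments inclg {G} H x.

Section Pairing.
Context (G A B : groupType).
Context (f : {multiplicative G -> A}) (h : {multiplicative G -> B}).

Definition pairg (g : G) : A * B := (f g, h g).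

Lemma pairgM : {morph pairg : x y / (x * y)%g}.
Proof. by move=> x y; rewrite /pairg !gmulfM. Qed.
HB.instance Definition _ := isMultiplicative.Build G (A * B)%type pairg pairgM.

Definition joint_image := subgroup (imageg pairg).
HB.instance Definition _ := Group.on joint_image.

Lemma proj1g_in (x : joint_image) : (subg_val x).1 \in imageg f.
Proof. by case: x => /= _ /asboolP[g ->]; apply/asboolP; exists g. Qed.

Definition proj1g (x : joint_image) : subgroup (imageg f) := Subgroup (proj1g_in x).

Lemma proj1gM : {morph proj1g : x y / (x * y)%g}.
Proof. by move=> x y; apply: val_inj. Qed.
HB.instance Definition _ :=
  isMultiplicative.Build joint_image (subgroup (imageg f)) proj1g proj1gM.

End Pairing.
Arguments proj1g {G A B} f h x.

Section Induced.
Context (F : fieldType) (W : lmodType F) (G : groupType) (H : groupClosed G).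
Context (sigma : {multiplicative subgroup H -> GL W}).

Definition ind_pred : {pred G -> W} := fun f =>
  `[< forall (h : subgroup H) (g : G), f (subg_val h * g)%g = sigma h (f g) >].

Lemma GL_linear (V : lmodType F) (s : GL V) : linear s.
Proof. exact: (autg_in s). Qed.

Lemma GL0 (V : lmodType F) (s : GL V) : s 0 = 0.
Proof. by have := GL_linear s (-1) 0 0; rewrite scaler0 addr0 scaleN1r addNr. Qed.

Lemma ind_pred_submod : submod_closed ind_pred.
Proof.
split=> [|a f f' /asboolP fP /asboolP f'P]; apply/asboolP => h g.
  by rewrite -[LHS]/0 -[X in sigma h X]/0 GL0.
rewrite -[LHS]/(a *: f (subg_val h * g)%g + f' (subg_val h * g)%g) fP f'P.
by rewrite -GL_linear.
Qed.

HB.instance Definition _ :=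
  GRing.isSubmodClosed.Build F (G -> W) ind_pred ind_pred_submod.

Record ind_space := IndSpace { ind_fun :> G -> W; ind_prop : ind_fun \in ind_pred }.

HB.instance Definition _ := [isSub for ind_fun].
HB.instance Definition _ := [Choice of ind_space by <:].
HB.instance Definition _ := [SubChoice_isSubLmodule of ind_space by <:].

Lemma ind_translate_in (g : G) (f : ind_space) :
  (fun x : G => f (x * g)%g) \in ind_pred.
Proof.
apply/asboolP => h x; have /asboolP := ind_prop f => fP.
by rewrite -mulgA fP.
Qed.

Definition ind_translate (g : G) (f : ind_space) : ind_space :=
  IndSpace (ind_translate_in g f).

Lemma ind_translateM g g' f :
  ind_translate (g * g')%g f = ind_translate g (ind_translate g' f).
Proof. by apply/val_inj/funext => x /=; rewrite mulgA. Qed.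

Lemma ind_translate1 f : ind_translate 1%g f = f.
Proof. by apply/val_inj/funext => x /=; rewrite mulg1. Qed.

Lemma ind_translate_GL g :
  `[< bijective (ind_translate g) /\ linear_selfmap ind_space (ind_translate g) >].
Proof.
apply/asboolP; split; last by move=> a f f'; apply/val_inj/funext.
exists (ind_translate g^-1%g) => f;
  by rewrite -ind_translateM ?mulVg ?mulgV ind_translate1.
Qed.

Definition indg (g : G) : GL ind_space := Autg (ind_translate_GL g).

Lemma indgM : {morph indg : x y / (x * y)%g}.
Proof. by move=> x y; apply: autgP => f; exact: ind_translateM. Qed.
HB.instance Definition _ := isMultiplicative.Build G (GL ind_space) indg indgM.

End Induced.

Section Restriction.
Context (G G' : groupType) (f : {multiplicative G -> G'}) (H : groupClosed G).

Definition resg (h : subgroup H) : G' := f (subg_val h).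

Lemma resgM : {morph resg : x y / (x * y)%g}.
Proof. by move=> x y; rewrite /resg gmulfM. Qed.
HB.instance Definition _ := isMultiplicative.Build (subgroup H) G' resg resgM.

End Restriction.
Arguments resg {G G'} f H h.

(* algC is the algebraic closure of Q; its ring automorphisms automatically fix
   the prime field. *)

Definition galQ := autg (ring_selfmap algC).
HB.instance Definition _ := Group.on galQ.

(* The pointwise stabilizers of finite sequences r are the groups
   Gal(Qbar / Q(r)), with Q(r) ranging over the finite extensions of Q. *)
Definition krull_nbhs (s : galQ) : set_system galQ :=
  [set A | exists r : seq algC, [set t : galQ | {in r, t =1 s}] `<=` A].

HB.instance Definition _ := hasNbhs.Build galQ krull_nbhs.

Lemma krull_nbhs_filter (s : galQ) : ProperFilter (nbhs s).
Proof.
split; first by case=> r /(_ s); apply.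
split.
- by exists [::].
- move=> A B [r rA] [r' rB]; exists (r ++ r') => t rt; split.
    by apply: rA => x xr; apply: rt; rewrite mem_cat xr.
  by apply: rB => x xr; apply: rt; rewrite mem_cat xr orbT.
- by move=> A B AB [r rA]; exists r => t /rA /AB.
Qed.

Lemma krull_nbhs_singleton (s : galQ) (A : set galQ) : nbhs s A -> A s.
Proof. by case=> r; apply. Qed.

Lemma krull_nbhs_nbhs (s : galQ) (A : set galQ) :
  nbhs s A -> nbhs s (nbhs^~ A).
Proof.
case=> r rA; exists r => t rt; exists r => u ru; apply: rA => x xr.
by rewrite ru // rt.
Qed.

HB.instance Definition _ := Nbhs_isNbhsTopological.Build galQ
  krull_nbhs_filter krull_nbhs_singleton krull_nbhs_nbhs.

(* A finite Galois extension K of Q inside Qbar is given by its embedding j. *)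
Section GaloisOfSubextension.
Context (K : splittingFieldType rat) (j : {rmorphism K -> algC}).

Definition gal_over_pred : {pred galQ} := fun s => `[< forall x : K, s (j x) = j x >].

Lemma gal_over1 : 1%g \in gal_over_pred.
Proof. exact/asboolP. Qed.

Lemma gal_overM : mulg_closed gal_over_pred.
Proof.
move=> s t /asboolP sP /asboolP tP; apply/asboolP => x.
by rewrite -[LHS]/(s (t (j x))) tP sP.
Qed.

Lemma gal_overV : invg_closed gal_over_pred.
Proof.
move=> s /asboolP sP; apply/asboolP => x.
by rewrite -[in LHS]sP -[LHS]/((s^-1 * s)%g (j x)) mulVg.
Qed.

HB.instance Definition _ := isMulClosed.Build galQ gal_over_pred gal_overM.
HB.instance Definition _ := isMul1Closed.Build galQ gal_over_pred gal_over1.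
HB.instance Definition _ := isInvClosed.Build galQ gal_over_pred gal_overV.


Lemma galQ_subext_stable (s : galQ) (x : K) : exists y : K, s (j x) = j y.
Proof.
have [sB [s1 sM]] := autg_in s.
pose HsB := GRing.isZmodMorphism.Build _ _ (s : algC -> algC) sB.
pose HsM := GRing.isMonoidMorphism.Build _ _ (s : algC -> algC) (s1, sM).
pose s' : {rmorphism algC -> algC} := HB.pack (s : algC -> algC) HsB HsM.
have [r pE] := splitting_field_normal 1%AS x.
pose p := map_poly j (minPoly 1%AS x).
have sp : map_poly s' p = p.
  apply/polyP => i; rewrite !coef_map /=.
  have /polyOverP/(_ i)/vlineP[a ->] := minPolyOver 1%AS x.
  have -> : j a%:A = ratr a := fmorph_eq_rat (j \o in_alg K) a.
  by rewrite -[LHS]/(s' (ratr a)) fmorph_rat.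
have : root p (s' (j x)).
  by rewrite -sp fmorph_root fmorph_root root_minPoly.
case/eqP: pE => pE; rewrite /p pE.
rewrite rmorph_prod /= (eq_bigr (fun a => 'X - (j a)%:P)); last first.
  by move=> a _; rewrite map_polyXsubC.
rewrite -(big_map j predT (fun a => 'X - a%:P)) root_prod_XsubC.
by case/mapP=> y _ yE; exists y.
Qed.

Lemma gal_over_normal (s t : galQ) : t \in gal_over_pred -> (s * t * s^-1)%g \in gal_over_pred.
Proof.
move=> /asboolP tP; apply/asboolP => x.
have [y xE] := galQ_subext_stable s^-1%g x.
rewrite -[LHS]/(s (t ((s^-1)%g (j x)))) xE tP -xE.
by rewrite -[LHS]/((s * s^-1)%g (j x)) mulgV.
Qed.

Definition gal_over : normalSubgroup galQ := NormalSubgroup gal_over_normal.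

End GaloisOfSubextension.

Section Integers.
Context (E : fieldExtType rat).

Definition int_pred : {pred E} := fun x => `[< integralOver (intr : int -> E) x >].

Lemma int_pred_subring : subring_closed int_pred.
Proof.
split; first exact/asboolP/integral1.
  by move=> x y /asboolP xP /asboolP yP; exact/asboolP/integral_sub.
by move=> x y /asboolP xP /asboolP yP; exact/asboolP/integral_mul.
Qed.
HB.instance Definition _ := GRing.isSubringClosed.Build E int_pred int_pred_subring.

Record int_ring := IntRing { int_val :> E; int_valP : int_val \in int_pred }.

HB.instance Definition _ := [isSub for int_val].
HB.instance Definition _ := [Choice of int_ring by <:].
HB.instance Definition _ := [SubChoice_isSubComNzRing of int_ring by <:].

End Integers.

Fixpoint ideal_exp (R : comNzRingType) (I : {pred R}) (n : nat) : set R :=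
  if n is n'.+1 then
    [set x | exists s : seq (R * R),
       (forall p, p \in s -> p.1 \in I /\ ideal_exp I n' p.2) /\
       x = \sum_(p <- s) p.1 * p.2]
  else setT.

#[short(type="uniformFieldType")]
HB.structure Definition UniformField := {F of GRing.Field F & UniformZmodule F}.

(* The completion of E at Lambda, up to unique isomorphism: a complete field
   containing E densely, whose uniform structure is that of a valuation
   extending the Lambda-adic one. The value of ac_val at 0 is irrelevant, and
   ac_val_adic determines ac_val on E, the fraction field of its integers. *)
Record adic_completion (E : fieldExtType rat)
    (Lambda : prime_idealr (int_ring E)) := AdicCompletion {
  ac_field :> uniformFieldType;
  ac_emb : {rmorphism E -> ac_field};
  ac_val : ac_field -> int;
  ac_valM : forall x y : ac_field, x != 0 -> y != 0 ->
    ac_val (x * y) = ac_val x + ac_val y;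
  ac_valD : forall x y : ac_field, x != 0 -> y != 0 -> x + y != 0 ->
    Num.min (ac_val x) (ac_val y) <= ac_val (x + y);
  ac_entourage : forall A : set (ac_field * ac_field), entourage A <->
    exists n : int, [set p | p.1 = p.2 \/ n <= ac_val (p.1 - p.2)] `<=` A;
  ac_complete : forall A : set_system ac_field,
    ProperFilter A -> cauchy A -> exists l : ac_field, A --> l;
  ac_val_adic : forall (a : int_ring E) (n : nat),
    ideal_exp Lambda n a -> ~ ideal_exp Lambda n.+1 a -> ac_val (ac_emb (int_val a)) = n;
  ac_dense : dense (range ac_emb) }.

(* GL(W) carries the topology of the space of matrices; the choice of the basis
   does not matter. *)
Definition GL_matrix (F : fieldType) (W : vectType F) (s : GL W) :
    'M[F]_(\dim {:W}) :=
  passmx.mxof (vbasis {:W}) (vbasis {:W}) (linfun s).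

Record galois_rep (F : uniformFieldType) (W : vectType F) := GaloisRep {
  rep_hom :> {multiplicative galQ -> GL W};
  rep_continuous : continuous (fun g : galQ => GL_matrix (rep_hom g)) }.

(* Main.v *)
Require Import Defs.
From HB Require Import structures.
From mathcomp Require Import all_boot all_order all_algebra all_field.
From mathcomp Require Import all_classical all_reals all_analysis.

(** Write [N] for the kernel of [pi]. The representation space of the induced
    representation [rho] contains, for every vector [w], the function supported
    on [H] whose value at [1] is [w]; since [W] is nonzero, an element acting
    trivially must lie in [H] ([indg_eq1_in]). Conversely an element of [H]
    acts trivially as soon as its conjugates act trivially on [W]
    ([indg_eq1]), so [rho] kills [H :&: N] because [N] is normal.

    The rest is group theory. The hypothesis [pi(G) = pi(H)] means [G = N H],
    hence [G / (H :&: N)] is the direct product of [G / H] and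
    [G / N = pi(G)]. The group [L] is [G] modulo the common kernel
    [H :&: N] of [pi] and [rho], so it is this direct product: the semidirect
    product law of the theorem can be taken with the trivial action
    ([joint_image_sdprod]). The splitting sends [pi(h)], for [h] in [H], to
    [(pi(h), rho(h))], which depends on [pi(h)] only ([proj1g_right_split]). *)

Set Implicit Arguments.
Unset Strict Implicit.
Unset Printing Implicit Defensive.

Import Order.TTheory GRing.Theory Num.Theory.

Local Open Scope classical_set_scope.
Local Open Scope ring_scope.

Lemma morph_eq1 (G A : groupType) (f : {multiplicative G -> A}) (x y : G) :
  f x = f y <-> f (x^-1 * y)%g = 1%g.
Proof.
rewrite gmulfM group_morphV; split=> [->|xy]; first exact: mulVg.
by apply: (mulgI (f x)^-1%g); rewrite xy mulVg.
Qed.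

Section JointImage.
Context (G A B : groupType).
Context (f : {multiplicative G -> A}) (h : {multiplicative G -> B}).
Local Notation L := (joint_image f h).
Local Notation Phi := (proj1g f h).

Lemma jointg_in (g : G) : pairg f h g \in imageg (pairg f h).
Proof. by apply/asboolP; exists g. Qed.

Definition jointg (g : G) : L := Subgroup (jointg_in g).

Lemma jointgM : {morph jointg : x y / (x * y)%g}.
Proof. by move=> x y; apply: val_inj; exact: pairgM. Qed.

Lemma jointg_surj (x : L) : exists g, x = jointg g.
Proof.
by have /asboolP[g gE] := subg_in x; exists g; apply: val_inj.
Qed.

Lemma jointg_eq (x y : G) : f x = f y -> h x = h y -> jointg x = jointg y.
Proof. by move=> fxy hxy; apply: val_inj; congr pair. Qed.

Lemma image_lift (c : subgroup (imageg f)) : exists g, subg_val c = f g.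
Proof. by have /asboolP[g gE] := subg_in c; exists g. Qed.

Lemma proj1g_short_exact : short_exact (inclg (kernelg Phi)) Phi.
Proof.
split; first exact: val_inj.
- apply/seteqP; split=> [_ [x _ <-]|b /= /eqP bK]; first exact/eqP/(subg_in x).
  by exists (Subgroup (bK : b \in kernelg Phi)).
- apply/seteqP; split=> // c _; have [g gE] := image_lift c.
  by exists (jointg g) => //; apply: val_inj.
Qed.

Section CommonKernel.
Context (H : normalSubgroup G).
Hypothesis f_onto : range f = f @` [set x | x \in H].
Hypothesis kerh : forall x, x \in H -> f x = 1%g -> h x = 1%g.

Lemma image_lift_in (c : subgroup (imageg f)) :
  exists x, x \in H /\ subg_val c = f x.
Proof.
have [g gE] := image_lift c.
have : range f (f g) by exists g.
by rewrite f_onto => -[x xH fx]; exists x; rewrite gE fx.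
Qed.

Definition lift_in (c : subgroup (imageg f)) : G := projT1 (cid (image_lift_in c)).

Lemma lift_inP c : lift_in c \in H /\ subg_val c = f (lift_in c).
Proof. by rewrite /lift_in; case: cid. Qed.

Lemma jointg_eq_in (x y : G) :
  (x^-1 * y)%g \in H -> f x = f y -> jointg x = jointg y.
Proof.
by move=> xyH fxy; apply: jointg_eq => //; apply/morph_eq1/kerh => //; apply/morph_eq1.
Qed.

Definition splitting (c : subgroup (imageg f)) : L := jointg (lift_in c).

Lemma splittingM : {morph splitting : c d / (c * d)%g}.
Proof.
move=> c d; rewrite /splitting -jointgM; apply: jointg_eq_in.
  have [[cH _] [dH _]] := (lift_inP c, lift_inP d).
  have [cdH _] := lift_inP (c * d)%g.
  by rewrite gpredM ?gpredV ?gpredM.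
have [[_ cE] [_ dE]] := (lift_inP c, lift_inP d).
by have [_ cdE] := lift_inP (c * d)%g; rewrite gmulfM -cE -dE -cdE.
Qed.
HB.instance Definition _ :=
  isMultiplicative.Build (subgroup (imageg f)) L splitting splittingM.

(** An element of the image of [f] lifts to [H], uniquely up to
    the kernel of [f] in [H], on which [h] is trivial: the pair formed by the
    values of [f] and [h] at the lift is therefore well defined, and
    multiplicative. *)
Lemma proj1g_right_split : right_split Phi.
Proof.
exists splitting; apply/funext => c; apply: val_inj.
exact/esym/(lift_inP c).2.
Qed.

Hypothesis kerh_in : forall x, h x = 1%g -> x \in H.

Definition joint_lift (x : L) : G := projT1 (cid (jointg_surj x)).

Lemma joint_liftK : cancel joint_lift jointg.
Proof. by move=> x; rewrite /joint_lift; case: cid => g /= <-. Qed.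

Local Notation theta := (@one_fun (subgroup (imageg f)) (autogroup (quotientg H))).

Definition joint_sdprod (x : L) : sdprodg theta :=
  (cosetg H (joint_lift x), Phi x).

(** The coset does not depend on the chosen lift, because two lifts of an
    element of [L] differ by an element of the kernel of [h], which lies in
    [H]. *)
Lemma joint_sdprod_jointg (g : G) :
  joint_sdprod (jointg g) = (cosetg H g, Phi (jointg g)).
Proof.
congr pair; apply/cosetgP/kerh_in/morph_eq1.
have := joint_liftK (jointg g); set y := joint_lift _.
by move=> /(congr1 (fun x : L => (subg_val x).2)).
Qed.

Lemma joint_sdprodM : {morph joint_sdprod : x y / (x * y)%g}.
Proof.
move=> x y; have [a ->] := jointg_surj x; have [b ->] := jointg_surj y.
rewrite -jointgM !joint_sdprod_jointg jointgM proj1gM.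
by congr pair; rewrite -cosetg_mul.
Qed.
HB.instance Definition _ :=
  isMultiplicative.Build L (sdprodg theta) joint_sdprod joint_sdprodM.

(** Surjectivity is the equality [G = N H], with [N] the kernel of [f]:
    given [a] and [g] in [G], some [x] in [H] has the same image under [f] as
    [a^-1 g], so that [a x] lies in the coset [a H] and [f] takes the same value
    at [a x] and at [g]. Injectivity holds because [h], like [f], is
    trivial on [N :&: H]. *)
Lemma joint_image_sdprod :
  exists theta : {multiplicative subgroup (imageg f) -> autogroup (quotientg H)},
    isomorphicg L (sdprodg theta).
Proof.
exists theta, joint_sdprod; rewrite -setTT_bijective.
rewrite -[X in set_bij _ _ X]/joint_sdprod; split=> // [x y _ _|].
  have [a ->] := jointg_surj x; have [b ->] := jointg_surj y.
  rewrite !joint_sdprod_jointg => -[/cosetgP abH fab].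
  exact: jointg_eq_in.
move=> [q c] _; have [a ->] := cosetg_surj q.
have [g gE] := image_lift c.
have [x [xH xE]] : exists x, x \in H /\ f (a^-1 * g)%g = f x.
  exact: image_lift_in (Phi (jointg (a^-1 * g)%g)).
exists (jointg (a * x)%g) => //; rewrite joint_sdprod_jointg; congr pair.
  by apply/esym/cosetgP; rewrite mulKg.
apply: val_inj; rewrite [RHS]gE -[LHS]/(f (a * x)%g) gmulfM -xE.
by rewrite -gmulfM mulVKg.
Qed.

End CommonKernel.
End JointImage.

Section InducedKernel.
Context (F : fieldType) (W : lmodType F) (G : groupType) (H : groupClosed G).
Context (sigma : {multiplicative subgroup H -> GL W}).

Definition ind_delta_fun (w : W) : G -> W :=
  fun x => if insub x is Some k then sigma k w else 0.

Lemma ind_delta_in (w : W) : ind_delta_fun w \in ind_pred sigma.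
Proof.
apply/asboolP => k g; rewrite /ind_delta_fun.
case: (insubP (subgroup H) g) => [k' gH k'E|gNH].
  have kgH : (subg_val k * g)%g \in H by rewrite gpredM ?(subg_in k).
  rewrite (insubT (fun x => x \in H) kgH) -[RHS]/((sigma k * sigma k')%g w).
  by rewrite -gmulfM; congr (sigma _ w); apply: val_inj; rewrite /= -k'E.
rewrite insubN ?GL0 //; apply: contra gNH => kgH.
by rewrite -(mulKg (subg_val k) g) gpredM ?gpredV ?(subg_in k).
Qed.

Definition ind_delta (w : W) : ind_space sigma := IndSpace (ind_delta_in w).

(** Translating by [g] the function supported on [H] with value [w] at [1]
    moves its support to [H g^-1]; if the function is fixed, this support still
    contains [1]. *)
Lemma indg_eq1_in (w : W) (g : G) : w != 0 -> indg sigma g = 1%g -> g \in H.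
Proof.
move=> w0 g1; have H1 : 1%g \in H by exact: gpred1.
have : ind_delta w (1 * g)%g = ind_delta w 1%g.
  by rewrite -[LHS]/(indg sigma g (ind_delta w) 1%g) g1.
rewrite mul1g /= /ind_delta_fun (insubT (fun x => x \in H) H1).
have -> : Sub 1%g H1 = 1%g :> subgroup H by apply: val_inj.
rewrite group_morph1; case: insubP => // _ /esym/eqP.
by rewrite (negbTE w0).
Qed.

(** At [x], translation by [g] amounts to applying [sigma] to the
    conjugate [x g x^-1]. *)
Lemma indg_eq1 (g : G) :
  (forall x, exists2 k : subgroup H, subg_val k = (x * g * x^-1)%g & sigma k = 1%g) ->
  indg sigma g = 1%g.
Proof.
move=> gP; apply: autgP => u; apply/val_inj/funext => x.
have [k kE k1] := gP x; have /asboolP/(_ k x) := ind_prop u.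
by rewrite kE mulgVK k1.
Qed.

End InducedKernel.

Theorem theorem3p19
  (E : fieldExtType rat) (Lambda : prime_idealr (int_ring E))
  (Lambda_neq0 : exists2 a : int_ring E, a \in Lambda & a != 0)
  (E_Lambda : adic_completion Lambda)
  (K : splittingFieldType rat) (j : {rmorphism K -> algC})
  (K_galois : galois 1%AS {:K}%AS)
  (W : vectType E_Lambda) (W_neq0 : (0 < \dim {:W})%N)
  (pi : galois_rep W) :
  let H := gal_over j in
  let rho := indg (resg pi H) in
  let Phi := proj1g pi rho in
  range pi = pi @` [set h | h \in H] ->
  [/\ short_exact (inclg (kernelg Phi)) Phi,
      right_split Phi &
      exists theta : {multiplicative subgroup (imageg pi) -> autogroup (quotientg H)},
        isomorphicg (joint_image pi rho) (sdprodg theta)].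
Proof.
move=> H rho Phi piGH.
have ker_rho x : x \in H -> pi x = 1%g -> rho x = 1%g.
  move=> xH pix1; apply: indg_eq1 => y.
  exists (Subgroup (Defs.normalP y xH)) => //.
  by rewrite -[LHS]/(pi (y * x * y^-1)%g) !gmulfM pix1 mulg1 -gmulfM mulgV group_morph1.
have ker_rho_in x : rho x = 1%g -> x \in H.
  apply: (@indg_eq1_in _ _ _ _ _ (vpick {:W})).
  by rewrite vpick0 -dimv_eq0 -lt0n.
split; first exact: proj1g_short_exact.
  exact: proj1g_right_split piGH ker_rho.
exact: joint_image_sdprod piGH ker_rho ker_rho_in.
Qed.
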